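(* Let $R$ be a ring. The following assertions are equivalent: (i) Every right $R$-module has $\perp$ equivalence. (ii) Every finitely generated right $R$-module has $\perp$ equivalence. (iii) Every left $R$-module has $\perp$ equivalence. (iv) Every finitely generated left $R$-module has $\perp$ equivalence. (v) $R$ is a PF ring (both left and right PF). (vi) $(X^{\perp})^{\perp}=X$ for every $R$-module $M$, right or left (i.e. for all right $R$-modules and for all left $R$-modules), and every submodule $X\leq M$. (vii) $R^{2}$ has $\perp$ equivalence (as a right $R$-module, or, what is equivalent, as a left $R$-module).
   Context: Rings are associative with unit, not necessarily commutative; modules are unital. For a right $R$-module $M$, $M^{*}=\mathrm{Hom}_{R}(M,R)$ is the left $R$-module of right-module morphisms $M\to R$ with $(r\cdot f)(x)=rf(x)$. The finite topology on $M^{*}$ is the linear topology with basis of open neighborhoods of $0$ given by the sets $\{f\in M^{*}\mid f|_F=0\}$, with $F$ ranging over finitely generated submodules of $M$; $\overline{Y}$ denotes closure in this topology. For a submodule $X\leq M$ put $X^{\perp}=\{f\in M^{*}\mid f|_{X}=0\}$, and for a left submodule $Y\leq M^{*}$ put $Y^{\perp}=\{x\in M\mid f(x)=0\ \forall f\in Y\}$. The module $M$ has $\perp$ equivalence (orthogonal equivalence) if $(X^{\perp})^{\perp}=X$ for all submodules $X\leq M$ and $(Y^{\perp})^{\perp}=\overline{Y}$ for all submodules $Y\leq M^{*}$; equivalently, $X\mapsto X^{\perp}$ and $Y\mapsto Y^{\perp}$ are mutually inverse anti-isomorphisms between the lattice of submodules of $M$ and the lattice of closed submodules of $M^{*}$.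 For a left $R$-module $M$ the notions are defined symmetrically, using the right $R$-module ${}^{*}M={}_{R}\mathrm{Hom}(M,R)$ in place of $M^{*}$. $R$ is left (right) PF if ${}_{R}R$ (resp. $R_{R}$) is injective and a cogenerator of the category of left (resp. right) $R$-modules; $R$ is a PF ring if it is both left and right PF. *)

(* Defs.v *)
From HB Require Import structures.
From mathcomp Require Import all_boot all_order all_algebra.
From mathcomp Require Import all_classical topology.

Set Implicit Arguments.
Unset Strict Implicit.
Unset Printing Implicit Defensive.

Import GRing.Theory.
Local Open Scope classical_set_scope.
Local Open Scope ring_scope.

(* All notions are stated for left modules; a right R-module is a left module
   over the converse ring R^c, with x r written r *: x. *)
Notation rmodType R := (lmodType R^c).

Definition submodule (S : pzRingType) (M : lmodType S) (X : set M) : Prop :=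
  GRing.submod_closed (mem X).

Definition fg_submodule (S : pzRingType) (M : lmodType S) (X : set M) : Prop :=
  exists s : seq M, X = smallest (@submodule S M) [set` s].

Definition fg_module (S : pzRingType) (M : lmodType S) : Prop :=
  fg_submodule [set: M].

(* Hom(M, S), a module on the other side: (r *: f) x = f x * r. When
   S is R^c, i.e. M is a right R-module, the product is that of R^c, so this
   is the left R-module structure (r f)(x) = r f(x). *)
Definition dual (S : pzRingType) (M : lmodType S) : Type := {scalar M}.

HB.instance Definition _ (S : pzRingType) (M : lmodType S) :=
  gen_eqMixin (dual M).
HB.instance Definition _ (S : pzRingType) (M : lmodType S) :=
  gen_choiceMixin (dual M).

Section DualModule.
Variables (S : pzRingType) (M : lmodType S).
Implicit Types (f g : dual M) (r : S^c).

Lemma dualP f g : (forall x, f x = g x) -> f = g.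
Proof.
case: f => f [[fa] [fs]]; case: g => g [[ga] [gs]] /= fg.
have {}fg : f = g by apply/funext.
subst g; congr (GRing.Linear.Pack (GRing.Linear.Class _ _));
  congr (_ _); exact: Prop_irrelevance.
Qed.

Fact dual_zero_linear : linear_for *%R (fun _ : M => 0 : S).
Proof. by move=> a u v; rewrite mulr0 addr0. Qed.
Definition dual_zero : dual M :=
  HB.pack (fun _ : M => 0 : S)
    (GRing.isLinear.Build S M S *%R _ dual_zero_linear).

Fact dual_opp_linear f : linear_for *%R (fun x : M => - f x).
Proof. by move=> a u v; rewrite linearP opprD mulrN. Qed.
Definition dual_opp f : dual M :=
  HB.pack (fun x : M => - f x)
    (GRing.isLinear.Build S M S *%R _ (dual_opp_linear f)).

Fact dual_add_linear f g : linear_for *%R (fun x : M => f x + g x).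
Proof. by move=> a u v; rewrite !linearP mulrDr addrACA. Qed.
Definition dual_add f g : dual M :=
  HB.pack (fun x : M => f x + g x)
    (GRing.isLinear.Build S M S *%R _ (dual_add_linear f g)).

Fact dual_scale_linear r f : linear_for *%R (fun x : M => f x * (r : S)).
Proof. by move=> a u v; rewrite linearP mulrDl mulrA. Qed.
Definition dual_scale r f : dual M :=
  HB.pack (fun x : M => f x * (r : S))
    (GRing.isLinear.Build S M S *%R _ (dual_scale_linear r f)).

Fact dual_addA : associative dual_add.
Proof. by move=> f g h; apply: dualP => x /=; rewrite addrA. Qed.
Fact dual_addC : commutative dual_add.
Proof. by move=> f g; apply: dualP => x /=; rewrite addrC. Qed.
Fact dual_add0 : left_id dual_zero dual_add.
Proof. by move=> f; apply: dualP => x /=; rewrite add0r. Qed.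
Fact dual_addN : left_inverse dual_zero dual_opp dual_add.
Proof. by move=> f; apply: dualP => x /=; rewrite addNr. Qed.

HB.instance Definition _ :=
  GRing.isZmodule.Build (dual M) dual_addA dual_addC dual_add0 dual_addN.

Fact dual_scaleA a b f :
  dual_scale a (dual_scale b f) = dual_scale (a * b) f.
Proof. by apply: dualP => x /=; rewrite -mulrA. Qed.
Fact dual_scale1 : left_id 1 dual_scale.
Proof. by move=> f; apply: dualP => x /=; rewrite mulr1. Qed.
Fact dual_scaleDr : right_distributive dual_scale +%R.
Proof. by move=> a f g; apply: dualP => x /=; rewrite mulrDl. Qed.
Fact dual_scaleDl f : {morph dual_scale^~ f : a b / a + b}.
Proof. by move=> a b; apply: dualP => x /=; rewrite mulrDr. Qed.

HB.instance Definition _ := GRing.Zmodule_isLmodule.Build S^c (dual M)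
  dual_scaleA dual_scale1 dual_scaleDr dual_scaleDl.

Lemma dualDE f g x : (f + g) x = f x + g x. Proof. by []. Qed.
Lemma dualZE r f x : (r *: f) x = f x * (r : S). Proof. by []. Qed.

End DualModule.

Definition perp (S : pzRingType) (M : lmodType S) (X : set M) : set (dual M) :=
  [set f | forall x, X x -> f x = 0].

Definition coperp (S : pzRingType) (M : lmodType S) (Y : set (dual M)) : set M :=
  [set x | forall f, Y f -> f x = 0].

(* The finite topology: the neighbourhoods of f are the supersets of the
   translates f + perp F with F a finitely generated submodule of M. *)
Definition dual_nbhs (S : pzRingType) (M : lmodType S) (f : dual M) :
    set_system (dual M) :=
  filter_from (@fg_submodule S M) (fun F => [set f + g | g in perp F]).

HB.instance Definition _ (S : pzRingType) (M : lmodType S) :=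
  hasNbhs.Build (dual M) (@dual_nbhs S M).

Section FiniteTopology.
Variables (S : pzRingType) (M : lmodType S).
Implicit Types (f : dual M) (A : set (dual M)).

Let perp0 (F : set M) : perp F 0.
Proof. by []. Qed.

Let perpD (F : set M) f g : perp F f -> perp F g -> perp F (f + g).
Proof.
by move=> Ff Fg x Fx; rewrite dualDE Ff// Fg// addr0.
Qed.

Let perpS (F G : set M) : F `<=` G -> perp G `<=` perp F.
Proof. by move=> FG f Gf x /FG/Gf. Qed.

Fact dual_nbhs_filter f : ProperFilter (nbhs f).
Proof.
apply: filter_from_proper; last by move=> F _; exists (f + 0), 0.
apply: filter_from_filter; first by exists (smallest (@submodule S M) [set` [::]]); exists [::].
move=> _ _ [s ->] [t ->].
exists (smallest (@submodule S M) [set` s ++ t]); first by exists (s ++ t).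
have sub u : {subset u <= s ++ t} -> smallest (@submodule S M) [set` u] `<=`
    smallest (@submodule S M) [set` s ++ t].
  by move=> ut x ux A [sA stA]; apply: ux; split=> // y /= /ut; exact: stA.
move=> _ [g pg <-]; split; exists g => //; apply: perpS pg; apply: sub => y;
  by rewrite mem_cat => ->; rewrite ?orbT.
Qed.

Fact dual_nbhs_singleton f A : nbhs f A -> A f.
Proof. by case=> F _; apply; exists 0 => //; rewrite addr0. Qed.

Fact dual_nbhs_nbhs f A : nbhs f A -> nbhs f (nbhs^~ A).
Proof.
case=> F fgF FA; exists F => // _ [g Fg <-]; exists F => // _ [h Fh <-].
by apply: FA; exists (g + h); [exact: perpD|rewrite addrA].
Qed.

HB.instance Definition _ := Nbhs_isNbhsTopological.Build (dual M)
  dual_nbhs_filter dual_nbhs_singleton dual_nbhs_nbhs.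

End FiniteTopology.

Definition perp_equivalence (S : pzRingType) (M : lmodType S) : Prop :=
  (forall X : set M, submodule X -> coperp (perp X) = X) /\
  (forall Y : set (dual M), submodule Y -> perp (coperp Y) = closure Y).

Definition injective_module (S : pzRingType) (E : lmodType S) : Prop :=
  forall (A B : lmodType S) (i : {linear A -> B}) (g : {linear A -> E}),
    injective i -> exists h : {linear B -> E}, h \o i =1 g.

Definition cogenerator (S : pzRingType) (C : lmodType S) : Prop :=
  forall (A B : lmodType S) (f g : {linear A -> B}),
    ~ (f =1 g) -> exists h : {linear B -> C}, ~ (h \o f =1 h \o g).

Definition left_PF (R : pzRingType) : Prop :=
  injective_module R^o /\ cogenerator R^o.

Definition right_PF (R : pzRingType) : Prop := left_PF R^c.

Definition PF (R : pzRingType) : Prop := left_PF R /\ right_PF R.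

(* Main.v *)
From HB Require Import structures.
Require Import Defs.
From mathcomp Require Import all_boot all_order all_algebra.
From mathcomp Require Import all_classical topology.

Set Implicit Arguments.
Unset Strict Implicit.
Unset Printing Implicit Defensive.

(** Three implications carry the theorem; everything else is a specialization or
    an exchange of the two sides.

    Torsionless quotients give the lattice statement. If (X^perp)^perp = X
    holds in all left and all right modules, then every left module M has perp
    equivalence. Let f vanish on Y^perp and let x_1, ..., x_n be elements of M.
    If (f x_1, ..., f x_n) were outside the right submodule
    {(g x_1, ..., g x_n) | g in Y} of R^n, some functional of R^n, that is some
    (a_1, ..., a_n) acting by left multiplication, would kill the submodule and
    not the vector; then sum_i a_i x_i lies in Y^perp but is not killed by f.
    So f agrees with an element of Y on the x_i, which is to say that f is in
    the closure of Y (double_annihilator_perp_equivalence).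

    Perp equivalence of R^2 gives injectivity. The dual of R^2 is discrete, so
    the hypothesis says that submodules of R^2, on either side, are their own
    double annihilators, hence that perp is a lattice anti-isomorphism. Given
    a left ideal I and f : I -> R, the graph G of f in R^2 meets 0 x R
    trivially; passing to annihilators, G^perp + R x 0 is the whole R^2. Writing
    (0, 1) in this sum yields a in R with x a + f(x) = 0 on I, so f is right
    multiplication by - a and Baer's criterion applies
    (double_annihilator2_baer). As proper left ideals also have nonzero right
    annihilators, the injective module R is moreover a cogenerator.

    A cogenerator separates each submodule X of M from the points outside it,
    through a functional on M / X (cogenerator_separates); this closes the
    circle.

    The argument alternates between R and R^c, and R^c^c is not the same ring
    structure as R. Annihilator conditions are therefore stated on functions
    'I_n -> R with the bare ring operations: they are then literally the same
    statement for R^c^c and for R. *)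

Import GRing.Theory.
Local Open Scope classical_set_scope.
Local Open Scope ring_scope.

(** * Submodules and dual modules *)

Section Submodules.
Variables (S : pzRingType) (M : lmodType S).
Implicit Types (X : set M).

Lemma submoduleP X :
  submodule X <-> X 0 /\ forall a u v, X u -> X v -> X (a *: u + v).
Proof.
split=> [[X0 XZ]|[X0 XZ]].
  split; first exact: set_mem.
  by move=> a u v /mem_set Xu /mem_set Xv; apply: set_mem; exact: XZ.
split; first exact: mem_set.
by move=> a u v /set_mem Xu /set_mem Xv; apply/mem_set; exact: XZ.
Qed.

Lemma submodule0 X : submodule X -> X 0.
Proof. by case/submoduleP. Qed.

Lemma submoduleZD X a u v : submodule X -> X u -> X v -> X (a *: u + v).
Proof. by case/submoduleP=> _; apply. Qed.

Lemma submoduleZ X a u : submodule X -> X u -> X (a *: u).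
Proof.
by move=> sX Xu; rewrite -[_ *: _]addr0; apply: submoduleZD => //; exact: submodule0.
Qed.

Lemma submoduleB X u v : submodule X -> X u -> X v -> X (u - v).
Proof.
by move=> sX Xu Xv; rewrite addrC -scaleN1r; exact: submoduleZD.
Qed.

Lemma submodule_coperp (Y : set (dual M)) : submodule (coperp Y).
Proof.
apply/submoduleP; split=> [f _|a u v Xu Xv f Yf]; first by rewrite linear0.
by rewrite linearP /= Xu// Xv// mulr0 addr0.
Qed.

Lemma submodule_sum X (I : finType) (a : I -> S) (x : I -> M) :
  submodule X -> (forall i, X (x i)) -> X (\sum_i a i *: x i).
Proof.
move=> sX Xx; elim/big_rec: _ => [|i y _ Xy]; first exact: submodule0.
exact: submoduleZD.
Qed.

Lemma dual_sum (I : finType) (f : dual M) (a : I -> S) (x : I -> M) :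
  f (\sum_i a i *: x i) = \sum_i a i * f (x i).
Proof. by rewrite linear_sum; apply: eq_bigr => i _; rewrite linearZ. Qed.

Lemma dualBE (f g : dual M) x : (f - g) x = f x - g x.
Proof. by []. Qed.

(** The target S^o of a module morphism and the target S of a scalar form carry
    the same operations but distinct structures. *)
Definition linear_dual (h : {linear M -> S^o}) : dual M :=
  HB.pack (fun x : M => h x : S)
    (GRing.isLinear.Build S M S *%R (fun x : M => h x : S)
       (fun a u v => linearP h a u v)).

End Submodules.

(** * Quotient modules and separation by functionals *)

Section Quotient.
Variables (S : pzRingType) (M : lmodType S) (X : set M).
Hypothesis sX : submodule X.

Definition submodule_pred : {pred M} := fun x => x \in X.

Fact submodule_pred_closed : zmod_closed submodule_pred.
Proof.
split=> [|u v /set_mem Xu /set_mem Xv]; apply: mem_set.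
  exact: submodule0.
exact: submoduleB.
Qed.

Definition submodule_zmodClosed : zmodClosed M :=
  HB.pack submodule_pred
    (GRing.isZmodClosed.Build M submodule_pred submodule_pred_closed).

Definition quotient_module : Type := Quotient.quot submodule_zmodClosed.
HB.instance Definition _ := GRing.Zmodule.on quotient_module.
Definition quotient_proj (x : M) : quotient_module :=
  (\pi_(Quotient.quot submodule_zmodClosed) x)%qT.
Definition quotient_repr (x : quotient_module) : M :=
  repr (x : Quotient.quot submodule_zmodClosed).

Fact quotient_reprK : cancel quotient_repr quotient_proj.
Proof. exact: reprK. Qed.

Fact quotient_projD : {morph quotient_proj : x y / x + y}.
Proof. exact: Quotient.pi_add. Qed.

Fact quotient_projP x y : quotient_proj x = quotient_proj y <-> X (x - y).
Proof.
split=> [/eqP|/mem_set xy]; first by rewrite -Quotient.idealrBE => /set_mem.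
by apply/eqP; rewrite -Quotient.idealrBE.
Qed.

Definition quotient_scale (a : S) (x : quotient_module) : quotient_module :=
  quotient_proj (a *: quotient_repr x).

Fact quotient_projZ a x :
  quotient_scale a (quotient_proj x) = quotient_proj (a *: x).
Proof.
apply/quotient_projP; rewrite -scalerBr; apply: submoduleZ => //.
exact/quotient_projP/quotient_reprK.
Qed.

Fact quotient_scaleA a b x :
  quotient_scale a (quotient_scale b x) = quotient_scale (a * b) x.
Proof. by rewrite -[x]quotient_reprK !quotient_projZ scalerA. Qed.
Fact quotient_scale1 : left_id 1 quotient_scale.
Proof. by move=> x; rewrite -[x]quotient_reprK !quotient_projZ scale1r. Qed.
Fact quotient_scaleDr : right_distributive quotient_scale +%R.
Proof.
move=> a x y; rewrite -[x]quotient_reprK -[y]quotient_reprK -quotient_projD.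
by rewrite !quotient_projZ scalerDr quotient_projD.
Qed.
Fact quotient_scaleDl x : {morph quotient_scale^~ x : a b / a + b}.
Proof.
move=> a b; rewrite -[x]quotient_reprK !quotient_projZ -quotient_projD.
by rewrite scalerDl.
Qed.

HB.instance Definition _ := GRing.Zmodule_isLmodule.Build S quotient_module
  quotient_scaleA quotient_scale1 quotient_scaleDr quotient_scaleDl.

Fact quotient_proj_linear : linear quotient_proj.
Proof. by move=> a x y; rewrite quotient_projD -quotient_projZ. Qed.

HB.instance Definition _ :=
  GRing.isLinear.Build S M quotient_module *:%R quotient_proj
    quotient_proj_linear.

Lemma quotient_proj_eq0 x : quotient_proj x = 0 <-> X x.
Proof. by rewrite -[0](linear0 quotient_proj) quotient_projP subr0. Qed.

End Quotient.

(** Equivalently, every left S-module is torsionless. *)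
Definition separates (S : pzRingType) : Prop :=
  forall (M : lmodType S) (X : set M), submodule X -> coperp (perp X) = X.

Section OrbitMap.
Variables (S : pzRingType) (M : lmodType S) (x : M).

Fact orbit_map_linear : linear (fun r : S^o => (r : S) *: x).
Proof. by move=> a u v; rewrite scalerDl scalerA. Qed.

Definition orbit_map : {linear S^o -> M} :=
  HB.pack (fun r : S^o => (r : S) *: x)
    (GRing.isLinear.Build S S^o M *:%R _ orbit_map_linear).

End OrbitMap.

(** A point x outside X gives two distinct maps S -> M / X, namely 0 and
    r |-> r x + X; a functional on M / X telling them apart does not vanish at x. *)
Lemma cogenerator_separates (S : pzRingType) :
  cogenerator (S^o : lmodType S) -> separates S.
Proof.
move=> cogS M X sX; rewrite eqEsubset; split; last by move=> x Xx f; apply.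
move=> x Xperp; apply: contrapT => nXx.
pose p : {linear M -> quotient_module sX} := quotient_proj sX.
have [|h nh] := cogS _ _ (orbit_map (p x)) \0.
  by move=> /(_ 1) /=; rewrite scale1r => /quotient_proj_eq0.
apply: nh => r /=; rewrite linear0 linearZ.
suff hpx0 : h (p x) = 0 by rewrite hpx0; exact: mulr0.
apply: (Xperp (linear_dual (h \o p))) => y /quotient_proj_eq0 /= py0.
by rewrite /p /= py0 linear0.
Qed.

(** * Double annihilators in free modules *)

(** Only the ring operations occur, not a module structure on I -> S, so that the
    notion for S^c^c unfolds to the notion for S. *)
Definition left_closed (S : pzRingType) (I : Type) (X : set (I -> S)) : Prop :=
  X (fun=> 0) /\ forall a u v, X u -> X v -> X (fun i => a * u i + v i).

(** The property that X is the left annihilator of its right annihilator, for all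
    left submodules X of S^n. *)
Definition double_annihilator (S : pzRingType) (n : nat) : Prop :=
  forall X : set ('I_n -> S), left_closed X -> forall v : 'I_n -> S,
    (forall w : 'I_n -> S, (forall u, X u -> \sum_i u i * w i = 0) ->
       \sum_i v i * w i = 0) -> X v.

(** Since the basic neighbourhoods of f consist of the functionals agreeing with f
    on a finitely generated submodule, closure means local interpolation. *)
Lemma dual_closure (S : pzRingType) (M : lmodType S) (Y : set (dual M)) f :
  closure Y f <-> forall F, fg_submodule F ->
    exists2 g, Y g & forall x, F x -> g x = f x.
Proof.
split=> [clY F fgF|Yf A [F fgF FA]].
  have [|g [Yg [h Fh fhg]]] := clY [set f + h | h in perp F]; first by exists F.
  by exists g => // x Fx; rewrite -fhg dualDE Fh// addr0.
have [g Yg gf] := Yf F fgF.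
exists g; split=> //; apply: FA; exists (g - f); last by rewrite addrC subrK.
by move=> x Fx; rewrite dualBE gf// subrr.
Qed.

Section FreeModule.
Variables (S : pzRingType) (n : nat).

Fact row_pairing_linear (w : 'I_n -> S) :
  linear_for *%R (fun x : 'rV[S]_n => \sum_i x 0 i * w i).
Proof.
move=> a u v; rewrite mulr_sumr -big_split; apply: eq_bigr => i _ /=.
by rewrite !mxE mulrDl mulrA.
Qed.

Definition row_pairing (w : 'I_n -> S) : dual 'rV[S]_n :=
  HB.pack (fun x : 'rV[S]_n => \sum_i x 0 i * w i)
    (GRing.isLinear.Build S 'rV[S]_n S *%R _ (row_pairing_linear w)).

Lemma row_pairingE w (x : 'rV[S]_n) : row_pairing w x = \sum_i x 0 i * w i.
Proof. by []. Qed.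

Lemma dual_rowE (f : dual 'rV[S]_n) x : f x = \sum_i x 0 i * f (delta_mx 0 i).
Proof. by rewrite {1}[x]row_sum_delta dual_sum. Qed.

Lemma fg_row : fg_module 'rV[S]_n.
Proof.
exists [seq delta_mx 0 i | i : 'I_n]; apply/esym/seteqP; split=> // x _ X [sX dX].
rewrite [x]row_sum_delta; apply: submodule_sum => // i.
by apply: dX; apply: (map_f (fun i => delta_mx 0 i)); rewrite mem_enum.
Qed.

Lemma row_double_annihilator :
  (forall X : set 'rV[S]_n, submodule X -> coperp (perp X) = X) ->
  double_annihilator S n.
Proof.
move=> perpK X [X0 XZ] v Xv.
pose X' : set 'rV[S]_n := [set x | X (fun i => x 0 i)].
suff: X' (\row_i v i).
  by rewrite /X' /=; congr X; apply/funext => i; rewrite mxE.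
rewrite -(perpK X'); last first.
  apply/submoduleP; split=> [|a u w X'u X'w]; rewrite /X' /=.
    by rewrite (_ : (fun _ => _) = fun=> 0)//; apply/funext => i; rewrite mxE.
  rewrite (_ : (fun _ => _) = fun i => a * u 0 i + w 0 i); first exact: XZ.
  by apply/funext => i; rewrite !mxE.
move=> f Xf; rewrite dual_rowE.
under eq_bigr do rewrite mxE.
apply: Xv => u Xu; rewrite -[RHS](Xf (\row_i u i)).
  by rewrite [RHS]dual_rowE; apply: eq_bigr => i _; rewrite mxE.
by rewrite /X' /= (_ : (fun _ => _) = u)//; apply/funext => i; rewrite mxE.
Qed.

(** S^n is finitely generated, so its dual is discrete and the closure in the
    hypothesis is Y itself; identifying the dual with the right module S^n turns
    the hypothesis into the double annihilator condition on the other side. *)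
Lemma row_dual_double_annihilator :
  (forall Y : set (dual 'rV[S]_n), submodule Y -> perp (coperp Y) = closure Y) ->
  double_annihilator S^c n.
Proof.
move=> coperpK Y [Y0 YZ] v Yv.
pose Y' : set (dual 'rV[S]_n) := [set f | Y (fun i => f (delta_mx 0 i))].
have sY' : submodule Y' by apply/submoduleP; split=> // a f g; exact: YZ.
have deltaE w i : row_pairing w (delta_mx 0 i) = w i.
  rewrite row_pairingE (bigD1 i)//= mxE !eqxx mul1r big1 ?addr0// => j ji.
  by rewrite mxE eqxx (negbTE ji) mul0r.
have YE w : Y' (row_pairing w) <-> Y w.
  by rewrite /Y' /= (_ : (fun _ => _) = w)//; apply/funext => i; exact: deltaE.
have : closure Y' (row_pairing v).
  rewrite -(coperpK Y')// => x Yx; rewrite row_pairingE.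
  apply: (Yv (fun i => x 0 i)) => u /YE Yu.
  exact: (Yx _ Yu).
move=> /dual_closure/(_ _ fg_row)[g Yg gv].
by apply/YE; rewrite -(_ : g = row_pairing v)//; apply: dualP => x; exact: gv.
Qed.

End FreeModule.

(** Interpolating f on x_1, ..., x_n by elements of Y is a membership in a right
    submodule of S^n, which the double annihilator condition reduces to the
    values of f on the combinations of the x_i lying in coperp Y. *)
Lemma double_annihilator_perp_equivalence (S : pzRingType) :
  separates S -> (forall n, double_annihilator S^c n) ->
  forall M : lmodType S, perp_equivalence M.
Proof.
move=> sepS annSc M; split; first exact: sepS.
move=> Y sY; rewrite eqEsubset; split=> f; last first.
  move=> /dual_closure Yf x Yx.
  have [|g Yg <-] := Yf (smallest (@submodule S M) [set` [:: x]]).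
  - by exists [:: x].
  - exact: Yx.
  - by move=> X [_]; apply; rewrite /= mem_head.
move=> Yf; apply/dual_closure => _ [s ->].
pose x (i : 'I_(size s)) := s`_i.
have [g Yg gf] : [set (fun i => g (x i)) | g in Y] (fun i => f (x i)).
  apply: (annSc _ _ _ (fun i => f (x i))).
    split; first by exists 0 => //; exact: submodule0.
    move=> a _ _ [g Yg <-] [h Yh <-]; exists (a *: g + h) => //.
    exact: submoduleZD.
  move=> w Yw; rewrite -[LHS](dual_sum f w x); apply: Yf => g Yg.
  by rewrite dual_sum; apply: (Yw (fun i => g (x i))); exists g.
(* f and g agree on the generators, and the zeros of f - g form a submodule. *)
have sfg : submodule (coperp [set f - g]) by exact: submodule_coperp.
exists g => // y /(_ (coperp [set f - g])) yP.
apply/esym/eqP; rewrite -subr_eq0 -dualBE; apply/eqP/yP => //; split=> // z.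
rewrite /= => sz h ->; have zs : (index z s < size s)%N by rewrite index_mem.
rewrite dualBE; apply/eqP; rewrite subr_eq0; apply/eqP/esym.
by have := congr1 (@^~ (Ordinal zs)) gf; rewrite /x /= nth_index.
Qed.

(** * Baer's criterion *)

(** Graphs of morphisms from a submodule of B to S. As sets of pairs they are
    ordered by inclusion, the order in which Zorn's lemma is applied to them. *)
Definition partial_functional (S : pzRingType) (B : lmodType S)
    (G : set (B * S^o)) : Prop :=
  submodule G /\ forall e, G (0, e) -> e = 0.

(** Baer's condition, the graph G standing for a morphism from a left ideal. *)
Definition baer (S : pzRingType) : Prop :=
  forall G : set (S^o * S^o), partial_functional G ->
    exists a : S, forall u, G u -> u.2 = (u.1 : S) * a.

Section Extension.
Variables (S : pzRingType) (B : lmodType S).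
Implicit Types G : set (B * S^o).

Lemma maximal_partial_functional G0 : partial_functional G0 ->
  exists G, [/\ partial_functional G, G0 `<=` G &
    forall G', partial_functional G' -> G `<=` G' -> G' = G].
Proof.
move=> pG0.
(* The empty chain has union set0, hence the first disjunct. *)
pose P G := G = set0 \/ partial_functional G /\ G0 `<=` G.
have nonempty G u : P G -> G u -> partial_functional G /\ G0 `<=` G.
  by case=> [->|].
have [F FP totF|G [PG maxG]] := @Zorn_bigcup _ P.
  have [Fe|/existsNP[u /contrapT [G1 FG1 G1u]]] :=
      pselect (forall u, ~ (\bigcup_(X in F) X) u).
    by left; rewrite -subset0 => u /Fe.
  right; have [[sG1 _] G01] := nonempty _ _ (FP _ FG1) G1u.
  split; last by move=> v /G01 G1v; exists G1.
  split; last first.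
    by move=> e [G FG Ge]; have [[_ +] _] := nonempty _ _ (FP _ FG) Ge; apply.
  apply/submoduleP; split; first by exists G1 => //; exact: submodule0.
  move=> a v w [G2 FG2 G2v] [G3 FG3 G3w].
  have [[sG2 _] _] := nonempty _ _ (FP _ FG2) G2v.
  have [[sG3 _] _] := nonempty _ _ (FP _ FG3) G3w.
  have [G23|G32] := totF _ _ FG2 FG3.
    by exists G3 => //; apply: submoduleZD => //; exact: G23.
  by exists G2 => //; apply: submoduleZD => //; exact: G32.
have [pG G0G] : partial_functional G /\ G0 `<=` G.
  case: PG => // G_0; have PG0 : P G0 by right; split.
  have [] := maxG G0 _ PG0; rewrite G_0; split=> // G0_0.
  by have /G0_0 := submodule0 pG0.1.
exists G; split=> // G' pG' GG'; apply: contrapT => nG'G.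
have /maxG : G `<` G'.
  by split=> // G'G; apply: nG'G; rewrite eqEsubset.
by apply; right; split=> //; exact: subset_trans GG'.
Qed.

(** On a maximal graph G, a point b is in the domain: the partial morphism
    r |-> G(r b) of S is right multiplication by some a, and adding (b, a) to G
    keeps it single-valued. *)
Lemma baer_extension G0 : baer S -> partial_functional G0 ->
  exists h : {linear B -> S^o}, forall u, G0 u -> h u.1 = u.2.
Proof.
move=> baerS /maximal_partial_functional[G [[sG G_0] G0G maxG]].
have totG b : exists e, G (b, e).
  have [|a aP] := baerS [set u | G ((u.1 : S) *: b, u.2)].
    split; last by move=> e; rewrite /= scale0r; exact: G_0.
    apply/submoduleP; split=> [|c u v Gu Gv] /=.
      by rewrite scale0r; exact: submodule0 sG.
    by rewrite scalerDl -scalerA; exact: (submoduleZD c sG Gu Gv).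
  pose G' : set (B * S^o) :=
    [set u | exists r : S, G (u.1 - r *: b, u.2 - r * a)].
  have GG' : G `<=` G'.
    by move=> [x e] Gu; exists 0; rewrite scale0r mul0r !subr0.
  have <- : G' = G.
    apply: maxG => //; split.
      apply/submoduleP; split; first by apply: GG'; exact: submodule0 sG.
      move=> c u v [r Gu] [t Gv]; exists (c * r + t) => /=.
      have := submoduleZD c sG Gu Gv; congr (G (_, _)).
        by rewrite /= scalerDl scalerBr opprD addrACA scalerA.
      by rewrite /= mulrDl [c *: _]mulrBr opprD addrACA mulrA.
    move=> e [r]; rewrite /= sub0r => Gre.
    have /aP/= : [set u | G ((u.1 : S) *: b, u.2)] (r, r * a - e).
      have := submoduleZ (-1) sG Gre; congr (G (_, _)).
        by rewrite /= scaleN1r opprK.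
      by rewrite /= [_ *: _]mulN1r opprB.
    by move/eqP; rewrite -subr_eq0 addrC addKr oppr_eq0 => /eqP.
  exists a, 1 => /=; rewrite scale1r mul1r !subrr; exact: submodule0 sG.
pose h b := sval (cid (totG b)).
have hG b : G (b, h b) by rewrite /h; case: cid.
have lin : linear h.
  move=> a u v; apply/eqP; rewrite -subr_eq0; apply/eqP/G_0.
  have := submoduleB sG (hG (a *: u + v)) (submoduleZD a sG (hG u) (hG v)).
  by congr (G (_, _)); rewrite /= subrr.
pose hL : {linear B -> S^o} :=
  HB.pack h (GRing.isLinear.Build S B S^o *:%R h lin).
exists hL => -[x e] /G0G Gxe.
apply/eqP; rewrite -subr_eq0; apply/eqP/G_0.
by have := submoduleB sG (hG x) Gxe; congr (G (_, _)); rewrite /= subrr.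
Qed.

End Extension.

(** * From the double annihilators of the square to the PF property *)

Local Notation i0 := (ord0 : 'I_2).
Local Notation i1 := (ord_max : 'I_2).

Section Pairs.
Variable S : pzRingType.

Lemma sum2 (u w : 'I_2 -> S) : \sum_i u i * w i = u i0 * w i0 + u i1 * w i1.
Proof.
rewrite big_ord_recl big_ord1; congr (_ + u _ * w _); exact/val_inj.
Qed.

Definition pair2 (a b : S) : 'I_2 -> S := fun i => if i == i0 then a else b.

End Pairs.

Section PF.
Variable S : pzRingType.

Lemma baer_injective : baer S -> injective_module (S^o : lmodType S).
Proof.
move=> baerS A B i g inj_i.
have [|h hP] := @baer_extension S B [set (i a, g a) | a in setT] baerS.
  split; last first.
    by move=> e [a _ [/eqP]]; rewrite (raddf_eq0 _ inj_i) => /eqP -> <-; rewrite linear0.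
  apply/submoduleP; split; first by exists 0 => //; rewrite !linear0.
  by move=> c _ _ [a _ <-] [b _ <-]; exists (c *: a + b) => //; rewrite !linearP.
by exists h => a; apply: (hP (i a, g a)); exists a.
Qed.

(** If f a <> g a, put x = f a - g a. The annihilator of x is a proper left ideal,
    killed by some c <> 0; then r x |-> r c is well defined on S x, sends x to c,
    and extends to B. *)
Lemma baer_cogenerator : baer S ->
  (forall I : set S^o, submodule I -> ~ I 1 ->
     exists2 c : S, c <> 0 & forall r, I r -> (r : S) * c = 0) ->
  cogenerator (S^o : lmodType S).
Proof.
move=> baerS annS A B f g nfg.
have /existsNP[a /eqP fga] : ~ forall a, f a = g a by [].
pose x := f a - g a.
have [|x0|c c0 cP] := annS [set r | (r : S) *: x = 0].
- apply/submoduleP; split=> [|r u v /= ux vx]; first by rewrite /= scale0r.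
  by rewrite scalerDl -scalerA ux vx scaler0 addr0.
- by move: fga; rewrite -subr_eq0 -/x -[x]scale1r x0 eqxx.
have [|h hP] := @baer_extension S B [set ((r : S) *: x, r * c) | r in setT] baerS.
  split; last by move=> e [r _ [rx0 <-]]; exact: cP.
  apply/submoduleP; split; first by exists 0 => //; rewrite scale0r mul0r.
  move=> b _ _ [r _ <-] [t _ <-]; exists (b * r + t) => //.
  by rewrite scalerDl -scalerA mulrDl -mulrA.
exists h => /(_ a) /= /eqP; rewrite -subr_eq0 -linearB -/x => /eqP hx0.
apply: c0; rewrite -hx0.
by have := hP (x, c); rewrite /= => ->//; exists 1 => //; rewrite scale1r mul1r.
Qed.

(** Y is G^perp + S x 0, a right submodule of S^2: the existential absorbs the
    first coordinate. Anything that annihilates Y is in G^perp^perp = G and in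
    (S x 0)^perp = 0 x S, hence is 0 because G is single-valued. So Y is all of
    S^2, and its element (0, 1) provides the multiplier. *)
Lemma double_annihilator2_baer :
  double_annihilator S 2 -> double_annihilator S^c 2 -> baer S.
Proof.
move=> annS annSc G [sG G_0].
pose Y : set ('I_2 -> S^c) :=
  [set v | exists a : S, forall u, G u -> (u.1 : S) * a + (u.2 : S) * v i1 = 0].
suff: Y (pair2 0 1).
  move=> [a aP]; exists (- a) => u /aP /eqP.
  by rewrite /pair2/= mulr1 mulrN addrC addr_eq0 => /eqP.
apply: annSc => [|w Yw].
  split; first by exists 0 => u _; rewrite !mulr0 addr0.
  move=> c u v [a aP] [b bP]; exists (a * (c : S) + b) => x Gx.
  (* the product of S^c, written in S *)
  change ((x.1 : S) * (a * (c : S) + b) +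
     (x.2 : S) * ((u i1 : S) * (c : S) + v i1) = 0).
  by rewrite !mulrDr !mulrA addrACA -mulrDl aP// bP// mul0r addr0.
have {}Yw v : Y v -> (w i0 : S) * v i0 + (w i1 : S) * v i1 = 0.
  by move=> /Yw; rewrite (@sum2 S^c).
have w0 : w i0 = 0.
  have := Yw (pair2 1 0); rewrite /pair2/= mulr1 mulr0 addr0; apply.
  by exists 0 => u _; rewrite !mulr0 addr0.
have Gw : [set u : 'I_2 -> S | G (u i0, u i1)] w.
  apply: annS => [|v Gv].
    split; first exact: submodule0 sG.
    by move=> a u v; exact: (submoduleZD a sG).
  rewrite sum2; apply: Yw; exists (v i0) => u Gu.
  have := Gv (pair2 u.1 u.2); rewrite sum2 /pair2/=; apply.
  by case: u Gu.
have w1 : w i1 = 0 by apply: G_0; rewrite -[in X in G X]w0.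
by rewrite (@sum2 S^c) w0 w1 !mulr0 addr0.
Qed.

(** A vector (w0, w1) annihilated by I x S has I w0 = 0. If that forced w0 = 0, the
    vector would also be annihilated by (1, 0), which would then belong to I x S. *)
Lemma double_annihilator2_annihilator : double_annihilator S 2 ->
  forall I : set S^o, submodule I -> ~ I 1 ->
     exists2 c : S, c <> 0 & forall r, I r -> (r : S) * c = 0.
Proof.
move=> annS I sI nI1; apply: contrapT => nc; apply: nI1.
suff: [set u : 'I_2 -> S | I (u i0)] (pair2 1 0) by [].
apply: annS => [|w Iw].
  split; first exact: submodule0 sI.
  by move=> a u v; exact: (submoduleZD a sI).
rewrite sum2 /pair2/= mul1r mul0r addr0; apply: contrapT => w0.
apply: nc; exists (w i0) => // r Ir.
by have := Iw (pair2 r 0) Ir; rewrite sum2 /pair2/= mul0r addr0.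
Qed.

Lemma double_annihilator2_PF :
  double_annihilator S 2 -> double_annihilator S^c 2 -> left_PF S.
Proof.
move=> annS annSc; have baerS := double_annihilator2_baer annS annSc.
split; first exact: baer_injective.
by apply: baer_cogenerator => //; exact: double_annihilator2_annihilator.
Qed.
End PF.

(** * The equivalences *)

Lemma perp_equivalence_row2_PF (S : pzRingType) :
  perp_equivalence 'rV[S]_2 -> left_PF S /\ left_PF S^c.
Proof.
move=> [perpK coperpK].
have annS := row_double_annihilator perpK.
have annSc := row_dual_double_annihilator coperpK.
by split; apply: double_annihilator2_PF.
Qed.

Lemma separates_perp_equivalence (S : pzRingType) :
  separates S -> separates S^c ->
  (forall M : lmodType S, perp_equivalence M) /\
  (forall M : lmodType S^c, perp_equivalence M).
Proof.
move=> sepS sepSc; split; apply: double_annihilator_perp_equivalence => // n.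
  by apply: row_double_annihilator => X; exact: sepSc.
(* The goal concerns S^c^c, and is convertible to the same condition for S. *)
exact: row_double_annihilator (fun X => sepS _ X).
Qed.

Theorem theorem2p9 (R : pzRingType) :
  [<-> (* (i) *)
       forall M : rmodType R, perp_equivalence M;
       (* (ii) *)
       forall M : rmodType R, fg_module M -> perp_equivalence M;
       (* (iii) *)
       forall M : lmodType R, perp_equivalence M;
       (* (iv) *)
       forall M : lmodType R, fg_module M -> perp_equivalence M;
       (* (v) *)
       PF R;
       (* (vi) *)
       (forall (M : rmodType R) (X : set M),
          submodule X -> coperp (perp X) = X) /\
       (forall (M : lmodType R) (X : set M),
          submodule X -> coperp (perp X) = X);
       (* (vii), for the right module R^2 *)
       perp_equivalence 'rV[R^c]_2;
       (* (vii), for the left module R^2 *)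
       perp_equivalence 'rV[R]_2].
Proof.
have PFall : PF R -> (forall M : lmodType R, perp_equivalence M) /\
    (forall M : rmodType R, perp_equivalence M).
  by move=> [[_ lC] [_ rC]]; apply: separates_perp_equivalence;
    exact: cogenerator_separates.
have row2l : perp_equivalence 'rV[R]_2 -> PF R by apply: perp_equivalence_row2_PF.
(* Taking R^c in the previous fact would end with PF modules over R^c^c; the
   passage through annihilator conditions avoids this. *)
have row2r : perp_equivalence 'rV[R^c]_2 -> PF R.
  move=> [perpK coperpK].
  have annRc := row_double_annihilator perpK.
  have annR := row_dual_double_annihilator coperpK.
  by split; apply: double_annihilator2_PF.
tfae.
- by [].
- by move=> fgP; have [] := PFall (row2r (fgP _ (fg_row _ _))).
- by [].
- by move=> fgP; exact: row2l (fgP _ (fg_row _ _)).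
- by move=> /PFall[lP rP]; split=> M; [case: (rP M)|case: (lP M)].
- move=> [rP lP]; have [_] := separates_perp_equivalence lP rP; exact.
- by move=> /row2r/PFall[+ _]; exact.
- by move=> /row2l/PFall[_]; exact.
Qed.
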